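(* Let $\mathcal H=\bigcup_{\alpha\in\Lambda}\mathcal K_\alpha$ be a locally Hilbert space, let $\mathcal A$ be a locally $C^*$-subalgebra of $B_{loc}(\mathcal H)$, and let $\mathfrak A=\overline{\mathcal A}^{SOT}$. Then: (1) $\mathcal A_{sa}$ is SOT-dense in $\mathfrak A_{sa}$; (2) for every real number $M>0$, $$\overline{\{a\in\mathcal A_{sa}:\ \|a|_{\mathcal K_\alpha}\|_{B(\mathcal K_\alpha)}\le M\ \ \forall\alpha\in\Lambda\}}^{SOT}=\{T\in\mathfrak A_{sa}:\ \|T|_{\mathcal K_\alpha}\|_{B(\mathcal K_\alpha)}\le M\ \ \forall\alpha\in\Lambda\}.$$
   Context: A locally Hilbert space is $\mathcal H=\bigcup_{\alpha\in\Lambda}\mathcal K_\alpha$ ($\Lambda$ directed, $\mathcal K_\alpha$ Hilbert spaces, $\mathcal K_\alpha$ a closed subspace of $\mathcal K_\beta$ for $\alpha\le\beta$) with the inductive limit topology. $B_{loc}(\mathcal H)$ is the $*$-algebra of linear maps $T:\mathcal H\to\mathcal H$ with $T(\mathcal K_\alpha)\subseteq\mathcal K_\alpha$, $T|_{\mathcal K_\alpha}\in B(\mathcal K_\alpha)$, compatible with the orthogonal projections $\mathcal K_\beta\to\mathcal K_\alpha$, with involution $(T^* )|_{\mathcal K_\alpha}=(T|_{\mathcal K_\alpha})^*$ and topology given by the seminorms $T\mapsto\|T|_{\mathcal K_\alpha}\|$. A locally $C^*$-subalgebra is a closed $*$-subalgebra (which is then a complete locally convex $*$-algebra whose seminorms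 satisfy $p(xy)\le p(x)p(y)$, $p(x^* )=p(x)$, $p(x^*x)=p(x)^2$). For a subset $X$, $X_{sa}$ denotes its self-adjoint elements. SOT is generated by the seminorms $T\mapsto\|Th\|$, $h\in\mathcal H$. *)

(* Defs.v *)
From HB Require Import structures.
From mathcomp Require Import all_boot all_order all_algebra.
From mathcomp Require Import complex.
From mathcomp Require Import boolp classical_sets reals constructive_ereal ereal.
From Stdlib Require List.

Set Implicit Arguments.
Unset Strict Implicit.
Unset Printing Implicit Defensive.
Import Order.TTheory GRing.Theory Num.Theory.
Local Open Scope ring_scope.
Local Open Scope classical_set_scope.

(* Scalars: the complex numbers R[i] over a real type R.
   The vector space V plays the role of H = \bigcup_a K_a (algebraically),
   with ip its (global) inner product, linear in the first argument. *)

Section LocHilbert.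
Variables (R : realType) (V : lmodType R[i]).

Definition is_inner_product (ip : V -> V -> R[i]) : Prop :=
  [/\ (forall (c : R[i]) x y z, ip (c *: x + y) z = c * ip x z + ip y z),
      (forall x y, ip x y = conjc (ip y x)),
      (forall x, 0 <= ip x x) &
      (forall x, ip x x = 0 -> x = 0)].

Definition nrm (ip : V -> V -> R[i]) (x : V) : R := Num.sqrt (complex.Re (ip x x)).

Definition directed_preorder (L : Type) (le : L -> L -> Prop) : Prop :=
  [/\ (forall a, le a a),
      (forall a b c, le a b -> le b c -> le a c) &
      (forall a b, exists c, le a c /\ le b c)].

Definition is_subspace (K : set V) : Prop :=
  K 0 /\ forall (c : R[i]) x y, K x -> K y -> K (c *: x + y).

Definition complete_in (ip : V -> V -> R[i]) (K : set V) : Prop :=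
  forall u : nat -> V, (forall n, K (u n)) ->
    (forall e : R, 0 < e -> exists N, forall m n, (N <= m)%N -> (N <= n)%N ->
        nrm ip (u m - u n) < e) ->
    exists l, K l /\ forall e : R, 0 < e -> exists N, forall n, (N <= n)%N ->
        nrm ip (u n - l) < e.

Definition locally_hilbert (ip : V -> V -> R[i]) (L : Type) (le : L -> L -> Prop)
    (K : L -> set V) : Prop :=
  [/\ is_inner_product ip,
      directed_preorder le,
      (forall a, is_subspace (K a) /\ complete_in ip (K a)),
      (forall a b, le a b -> K a `<=` K b) &
      (forall x, exists a, K a x)].

Section Ops.
Variables (ip : V -> V -> R[i]) (L : Type) (K : L -> set V).

Definition opnorm (T : V -> V) (a : L) : \bar R :=
  ereal_sup [set ((nrm ip (T x))%:E) | x in [set x | K a x /\ nrm ip x <= 1]].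

Definition is_linear_map (T : V -> V) : Prop :=
  forall (c : R[i]) x y, T (c *: x + y) = c *: T x + T y.

Definition loc_adjoint (T S : V -> V) : Prop :=
  forall a, (forall x, K a x -> K a (S x)) /\
            (forall x y, K a x -> K a y -> ip (T x) y = ip x (S y)).

(* B_loc(H): T(K a) <= K a, T|_{K a} bounded, and T commutes with the
   orthogonal projections K b -> K a (a <= b), i.e. T maps K b (-) K a into itself. *)
Definition Bloc (le : L -> L -> Prop) (T : V -> V) : Prop :=
  [/\ is_linear_map T,
      (forall a x, K a x -> K a (T x)),
      (forall a, (opnorm T a < +oo)%E) &
      (forall a b, le a b -> forall x, K b x ->
         (forall y, K a y -> ip x y = 0) ->
         (forall y, K a y -> ip (T x) y = 0))].

Definition loc_Cstar_subalgebra (le : L -> L -> Prop) (A : set (V -> V)) : Prop :=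
  A `<=` Bloc le /\
  A (fun _ => 0) /\
  (forall (c : R[i]) S T, A S -> A T -> A (fun x => c *: S x + T x)) /\
  (forall S T, A S -> A T -> A (fun x => S (T x))) /\
  (forall T S, A T -> loc_adjoint T S -> A S) /\
      (forall T, Bloc le T ->
        (forall (al : seq L) (e : R), 0 < e -> exists a, A a /\
           forall b, List.In b al -> (opnorm (fun x => (T x - a x)%R) b <= e%:E)%E) ->
        A T).

Definition sot_closure (le : L -> L -> Prop) (X : set (V -> V)) : set (V -> V) :=
  [set T | Bloc le T /\
     forall (hs : seq V) (e : R), 0 < e -> exists a, X a /\
        forall h, List.In h hs -> nrm ip (T h - a h) < e].

Definition sa_part (X : set (V -> V)) : set (V -> V) :=
  [set T | X T /\ loc_adjoint T T].

End Ops.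
End LocHilbert.

(* Main.v *)
(* (1) The self-adjoint part of [S] depends weakly continuously on [S], and on a finite
   power of [K a] the weak and norm closures of a real subspace coincide (Mazur); since
   finitely many vectors lie in a common [K a], self-adjoint weak limits of [A] are strong
   limits of [A_sa].

   (2) Kaplansky's argument with [f t = 2 t / (1 + t^2)], which maps the reals to [[-1, 1]].
   For [a] in [A_sa] the operator [f a] is a contraction, lies in [A] because on each [K a]
   it is a uniform limit of polynomials in [a] without constant term, and depends strongly
   continuously on [a].  A self-adjoint [T] with [|T| <= q < 1] is approximately [f S], where
   [S] is obtained by iterating [S |-> (T + T S^2) / 2]; approximate [S] by [a] using (1).

   Self-adjointness is handled through the real inner product [Re (ip x y)]. *)

Require Import Defs.
From HB Require Import structures.
From mathcomp Require Import all_boot all_order all_algebra.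
From mathcomp Require Import complex.
From mathcomp Require Import boolp classical_sets reals constructive_ereal ereal.
From mathcomp Require Import ring lra.
From Stdlib Require List.
Set Implicit Arguments.
Unset Strict Implicit.
Unset Printing Implicit Defensive.
Import Order.TTheory GRing.Theory Num.Theory.
Local Open Scope ring_scope.
Local Open Scope classical_set_scope.

Local Notation "t *r x" := ((real_complex _ t) *: x) (at level 40).

(** * The real inner product *)

Section RealForm.
Variables (R : realType) (V : lmodType R[i]) (ip : V -> V -> R[i]).
Hypothesis Hip : is_inner_product ip.

Definition real_ip (x y : V) : R := complex.Re (ip x y).
Local Notation rip := real_ip.
Local Notation nrm := (nrm ip).
Implicit Types (x y z : V) (t : R).

Lemma ripC x y : rip x y = rip y x.
Proof. by case: Hip => _ H _ _; rewrite /real_ip H; case: (ip y x). Qed.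

Lemma ripD x y z : rip (x + y) z = rip x z + rip y z.
Proof.
case: Hip => H _ _ _; rewrite /real_ip -{1}[x]scale1r H mul1r.
by case: (ip x z) (ip y z) => ? ? [].
Qed.

Lemma ip0l z : ip 0 z = 0.
Proof.
case: Hip => H _ _ _.
have := H 1 0 0 z; rewrite scale1r addr0 mul1r => /eqP.
by rewrite -subr_eq0 opprD addNKr oppr_eq0 => /eqP.
Qed.

Lemma ipZl (c : R[i]) x z : ip (c *: x) z = c * ip x z.
Proof. by case: Hip => H _ _ _; rewrite -[c *: x]addr0 H ip0l addr0. Qed.

Lemma ripZ t x z : rip (t *r x) z = t * rip x z.
Proof. by rewrite /real_ip ipZl; case: (ip x z) => a b /=; rewrite mul0r subr0. Qed.

Lemma ripN x z : rip (- x) z = - rip x z.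
Proof. by rewrite -scaleN1r -[-1 in LHS](rmorphN1 (real_complex R)) ripZ mulN1r. Qed.

Lemma rip0 z : rip 0 z = 0.
Proof. by rewrite /real_ip ip0l. Qed.

Lemma ripDr x y z : rip z (x + y) = rip z x + rip z y.
Proof. by rewrite ripC ripD !(ripC z). Qed.
Lemma ripZr t x z : rip z (t *r x) = t * rip z x.
Proof. by rewrite ripC ripZ !(ripC z). Qed.
Lemma ripNr x z : rip z (- x) = - rip z x.
Proof. by rewrite ripC ripN !(ripC z). Qed.
Lemma rip0r z : rip z 0 = 0.
Proof. by rewrite ripC rip0. Qed.

Definition ripE := (ripD, ripDr, ripN, ripNr, ripZ, ripZr, rip0, rip0r).

Lemma rip_ge0 x : 0 <= rip x x.
Proof. by case: Hip => _ _ /(_ x) + _; rewrite /real_ip lecE => /andP[]. Qed.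

Lemma rip_eq0 x : rip x x = 0 -> x = 0.
Proof.
case: Hip => _ _ /(_ x) + /(_ x) H; rewrite /real_ip lecE => /andP[/eqP h _] r.
by apply: H; apply/eqP; rewrite eq_complex h r !eqxx.
Qed.

(* Turns an identity between vectors into a scalar identity that [ring] decides. *)
Lemma rip_ext x y : (forall z, rip x z = rip y z) -> x = y.
Proof.
move=> h; apply/eqP; rewrite -subr_eq0; apply/eqP/rip_eq0.
by rewrite ripD ripN h subrr.
Qed.

(** The imaginary part of [ip] is the real form with its first argument rotated by [-i]; this lifts
    real identities for complex-linear maps to [ip]. *)
Lemma ip_rip x y : ip x y = Complex (rip x y) (rip (- 'i%C *: x) y).
Proof.
by rewrite /real_ip ipZl; case: (ip x y) => a b /=; rewrite oppr0 mul0r sub0r mulN1r opprK.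
Qed.

Lemma ripZi x y : rip (- 'i%C *: x) y = rip x ('i%C *: y).
Proof.
case: Hip => _ H _ _; rewrite /real_ip (H x) !ipZl (H x).
by case: (ip y x) => a b /=; ring.
Qed.

Lemma nrm_ge0 x : 0 <= nrm x. Proof. exact: sqrtr_ge0. Qed.

Lemma nrm_sqr x : nrm x ^+ 2 = rip x x.
Proof. by rewrite sqr_sqrtr // rip_ge0. Qed.

Lemma nrm_eq0 x : nrm x = 0 -> x = 0.
Proof. by move=> h; apply: rip_eq0; rewrite -nrm_sqr h expr0n. Qed.

Lemma nrm0 : nrm 0 = 0.
Proof. by apply/eqP; rewrite -sqrf_eq0 nrm_sqr rip0. Qed.

Lemma nrm_le x t : 0 <= t -> rip x x <= t ^+ 2 -> nrm x <= t.
Proof. by move=> t0 h; rewrite -(@ler_pXn2r _ 2) ?nnegrE ?nrm_ge0 // nrm_sqr. Qed.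

Lemma nrmZ t x : nrm (t *r x) = `|t| * nrm x.
Proof.
apply/eqP; rewrite -(@eqrXn2 _ 2) ?mulr_ge0 ?nrm_ge0 ?normr_ge0 //.
by rewrite exprMn !nrm_sqr real_normK ?num_real // !ripE mulrA expr2.
Qed.

Lemma nrmN x : nrm (- x) = nrm x.
Proof. by rewrite /nrm -!/(rip _ _) !ripE opprK. Qed.

Lemma nrmB x y : nrm (x - y) = nrm (y - x).
Proof. by rewrite -nrmN opprB. Qed.

(** Expand the squared norm of [|y|^2 x - <x,y> y] and divide by [|y|^2]. *)
Lemma rip_sqr_le x y : rip x y ^+ 2 <= rip x x * rip y y.
Proof.
have [y0|y0] := eqVneq (rip y y) 0.
  by rewrite (rip_eq0 y0) !ripE; lra.
have yp : 0 < rip y y by rewrite lt_def y0 rip_ge0.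
have := rip_ge0 (rip y y *r x - rip x y *r y); rewrite !ripE (ripC y x).
move=> h; rewrite -subr_ge0 -(pmulr_rge0 _ yp).
by apply: le_trans h _; rewrite le_eqVlt; apply/orP; left; apply/eqP; ring.
Qed.

Lemma cauchy_schwarz x y : `|rip x y| <= nrm x * nrm y.
Proof.
rewrite -(@ler_pXn2r _ 2) ?nnegrE ?mulr_ge0 ?nrm_ge0 //.
by rewrite exprMn !nrm_sqr real_normK ?num_real // rip_sqr_le.
Qed.

Lemma rip_le x y : rip x y <= nrm x * nrm y.
Proof. exact: le_trans (ler_norm _) (cauchy_schwarz _ _). Qed.

Lemma nrmD x y : nrm (x + y) <= nrm x + nrm y.
Proof.
apply: nrm_le; first by rewrite addr_ge0 ?nrm_ge0.
rewrite !ripE (ripC y x) sqrrD !nrm_sqr; have := rip_le x y; lra.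
Qed.

Lemma nrmD_le x y (a b : R) : nrm x <= a -> nrm y <= b -> nrm (x + y) <= a + b.
Proof. by move=> h k; apply: le_trans (nrmD _ _) (lerD h k). Qed.

Lemma nrm_triangle y x z : nrm (x - z) <= nrm (x - y) + nrm (y - z).
Proof. by have := nrmD (x - y) (y - z); rewrite addrA subrK. Qed.

End RealForm.

(** * Archimedean estimates *)

Section Archimedean.
Variable R : realType.

Lemma small_inv (e : R) : 0 < e -> exists n : nat, forall m, (n <= m)%N -> m.+1%:R^-1 < e.
Proof.
move=> e0; exists (Num.bound e^-1) => m nm.
rewrite invf_plt ?posrE ?ltr0n //; apply: lt_le_trans (archi_boundP _) _.
  by rewrite invr_ge0 ltW.
by rewrite ler_nat (leq_trans nm).
Qed.

(** Bernoulli's inequality in the form [k^n (1 + n (1 - k)) <= 1]. *)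
Lemma small_geometric (k e : R) : 0 <= k -> k < 1 -> 0 < e -> exists n, k ^+ n < e.
Proof.
move=> k0 k1 e0.
have bern n : k ^+ n * (1 + n%:R * (1 - k)) <= 1.
  elim: n => [|n IH]; first by rewrite expr0 mul0r addr0 mulr1.
  have kn : 0 <= k ^+ n by rewrite exprn_ge0.
  have n0 : 0 <= n%:R :> R by rewrite ler0n.
  rewrite exprSr -natr1; apply: le_trans IH.
  rewrite -mulrA ler_wpM2l //.
  have : 0 <= (n%:R + 1) * (1 - k) ^+ 2 by rewrite mulr_ge0 ?sqr_ge0 // addr_ge0.
  nra.
pose n := Num.bound ((e * (1 - k))^-1).
have ek : 0 < e * (1 - k) by rewrite mulr_gt0 ?subr_gt0.
have hn : (e * (1 - k))^-1 < n%:R by apply: archi_boundP; rewrite invr_ge0 ltW.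
exists n; rewrite ltNge; apply/negP => h.
have h1 : 1 < n%:R * (e * (1 - k)) by rewrite -ltr_pdivrMr // div1r.
have h2 : 0 <= n%:R * (1 - k) by rewrite mulr_ge0 // subr_ge0 ltW.
have := bern n; have := ler_wpM2r (addr_ge0 (@ler01 R) h2) h; nra.
Qed.

End Archimedean.

(** * Riesz representation and weak closures *)

Section Riesz.
Variables (R : realType) (V : lmodType R[i]) (ip : V -> V -> R[i]).
Hypothesis Hip : is_inner_product ip.
Local Notation nrm := (nrm ip).
Local Notation rip := (real_ip ip).
Let ripE := (ripE Hip).

Lemma eps_eq0 (d k : R) : 0 < k -> (forall e, 0 < e -> `|d| <= e * k) -> d = 0.
Proof.
move=> k0 h; apply/eqP; rewrite -normr_eq0 eq_le normr_ge0 andbT leNgt.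
apply/negP => d0; have := h (`|d| / (k + k)); rewrite divr_gt0 ?addr_gt0 // => /(_ isT).
have -> : `|d| / (k + k) * k = `|d| / 2 by field; rewrite gt_eqF // addr_gt0.
lra.
Qed.

Lemma nrm_lt x (t : R) : 0 < t -> rip x x < t ^+ 2 -> nrm x < t.
Proof. by move=> t0 h; rewrite -(@ltr_pXn2r _ 2) ?nnegrE ?nrm_ge0 ?ltW // nrm_sqr. Qed.

Definition adherent (W : set V) (l : V) : Prop :=
  forall e : R, 0 < e -> exists w, W w /\ nrm (w - l) < e.

Definition real_subspace (W : set V) : Prop :=
  [/\ W 0, (forall x y, W x -> W y -> W (x + y)) &
      (forall (t : R) x, W x -> W (t *r x))].

(* The minimizing sequences of [|w|^2 - 2 phi w] over [W] are Cauchy by the parallelogram law. *)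
Lemma riesz_adherent (C W : set V) (phi : V -> R) (M : R) :
  complete_in ip C -> W `<=` C -> real_subspace W ->
  (forall x y, W x -> W y -> phi (x + y) = phi x + phi y) ->
  (forall t x, W x -> phi (t *r x) = t * phi x) ->
  (forall x, W x -> `|phi x| <= M * nrm x) ->
  exists l, [/\ C l, adherent W l & forall w, W w -> phi w = rip w l].
Proof.
move=> Cc WC [W0 WD WZ] phiD phiZ phiM.
pose Q w := rip w w - 2 * phi w.
pose S := [set Q w | w in W].
have Sinf : has_inf S.
  split; first by exists (Q 0); exists 0.
  exists (- M ^+ 2) => _ [w Ww <-].
  rewrite /Q -(nrm_sqr Hip); have := phiM w Ww; rewrite ler_norml => /andP[_ h].
  have := sqr_ge0 (nrm w - M); rewrite sqrrB; lra.
pose m := inf S.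
have mQ w : W w -> m <= Q w by move=> Ww; apply: ge_inf; [case: Sinf|exists w].
have /choice[u Hu] (n : nat) : exists w, W w /\ Q w < m + n.+1%:R^-1.
  have [|_ [w Ww <-] h] := @inf_adherent _ S n.+1%:R^-1 _ Sinf.
    by rewrite invr_gt0 ltr0n.
  by exists w.
have par x y : W x -> W y -> rip (x - y) (x - y) <= 2 * (Q x + Q y) - 4 * m.
  (* The midpoint of [x] and [y] stays in [W], so [Q] is at least [m] there. *)
  move=> Wx Wy; have := mQ (2^-1 *r (x + y)) (WZ _ _ (WD _ _ Wx Wy)).
  rewrite /Q phiZ ?phiD //; last exact: WD.
  rewrite !ripE (ripC Hip y x) => h.
  lra.
have [e e0|l [Cl ul]] := Cc u (fun n => WC _ (Hu n).1).
  have [|N HN] := @small_inv R (e ^+ 2 / 4); first by rewrite divr_gt0 ?exprn_gt0.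
  exists N => i j Ni Nj; apply: nrm_lt => //.
  apply: le_lt_trans (par _ _ (Hu i).1 (Hu j).1) _.
  have := HN _ Ni; have := HN _ Nj; have := (Hu i).2; have := (Hu j).2.
  move: (i.+1%:R^-1) (j.+1%:R^-1) => p q.
  lra.
exists l; split=> // [e e0|w Ww].
  by have [N HN] := ul e e0; exists (u N); split; [case: (Hu N)|exact: HN].
apply/eqP; rewrite -subr_eq0; apply/eqP.
apply: (@eps_eq0 _ (1 + nrm w ^+ 2 + 2 * nrm w)).
  have := sqr_ge0 (nrm w); have := nrm_ge0 ip w; lra.
move=> e e0.
have [N1 HN1] := ul e e0.
have [|N2 HN2] := @small_inv R (e ^+ 2); first by rewrite exprn_gt0.
pose n := maxn N1 N2.
have h1 : nrm (u n - l) < e by apply: HN1; rewrite leq_maxl.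
have h2 : n.+1%:R^-1 < e ^+ 2 by apply: HN2; rewrite leq_maxr.
have h3 := (Hu n).2; have Wu := (Hu n).1.
have h4 : `|rip (u n - l) w| <= e * nrm w.
  apply: le_trans (cauchy_schwarz Hip _ _) _.
  by rewrite ler_wpM2r ?nrm_ge0 ?(ltW h1).
(* Perturb the almost minimal [u n] by [t w]; taking [t = e] and [t = - e] bounds
   [rip (u n) w - phi w] from both sides. *)
have Qt t : 0 <= e ^+ 2 + 2 * t * (rip (u n) w - phi w) + t ^+ 2 * nrm w ^+ 2.
  have := mQ _ (WD _ _ Wu (WZ t _ Ww)).
  rewrite /Q phiD ?phiZ //; last exact: WZ.
  rewrite !ripE (ripC Hip w (u n)) (nrm_sqr Hip).
  move: h2 h3; rewrite /Q; move: (n.+1%:R^-1) => p.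
  lra.
move: h4; rewrite !ripE ler_norml => /andP[h5 h6].
have Q1 := Qt e; have Q2 := Qt (- e).
have B0 := nrm_ge0 ip w; rewrite (ripC Hip w l).
have {}h5 := ler_wpM2l (ltW e0) h5; have {}h6 := ler_wpM2l (ltW e0) h6.
have e2 : 0 <= e ^+ 2 * nrm w by rewrite mulr_ge0 ?sqr_ge0.
have e3 : 0 <= e ^+ 2 * nrm w ^+ 2 by rewrite mulr_ge0 ?sqr_ge0.
have e4 := sqr_ge0 e.
by rewrite ler_norml; apply/andP; split; rewrite -(ler_pM2l e0); lra.
Qed.

(** Let [l] be the projection of [v] on the norm closure of [W]. Then [v - l] is orthogonal to [W],
    hence to its weak limit [v] and to its norm limit [l], hence to itself. *)
Lemma weakly_adherent (C W : set V) (v : V) :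
  complete_in ip C -> is_subspace C -> W `<=` C -> real_subspace W -> C v ->
  (forall z e, C z -> 0 < e -> exists w, W w /\ `|rip (w - v) z| < e) ->
  adherent W v.
Proof.
move=> Cc [C0 CL] WC Wsub Cv weak.
have [||w _|l [Cl Wl lv]] := @riesz_adherent C W (fun w => rip w v) (nrm v) Cc WC Wsub.
- by move=> x y _ _; rewrite !ripE.
- by move=> t x _; rewrite !ripE.
- by rewrite mulrC; apply: cauchy_schwarz.
suff -> : v = l by [].
have Cz : C (v - l) by rewrite addrC -scaleN1r; apply: CL.
have z0 : rip v (v - l) = 0.
  apply: (@eps_eq0 _ 1) => // e e0; rewrite mulr1.
  have [w [Ww h]] := weak _ e Cz e0.
  have E : rip (w - v) (v - l) = - rip v (v - l) by rewrite !ripE (lv w Ww); ring.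
  by move: h; rewrite E normrN => /ltW.
have l0 : rip l (v - l) = 0.
  apply: (@eps_eq0 _ (1 + nrm (v - l))); first by rewrite ltr_pwDl ?nrm_ge0.
  move=> e e0; have [w [Ww h]] := Wl e e0.
  have -> : rip l (v - l) = - rip (w - l) (v - l) by rewrite !ripE (lv w Ww); ring.
  rewrite normrN; apply: le_trans (cauchy_schwarz Hip _ _) _.
  by apply: ler_pM; rewrite ?nrm_ge0 ?(ltW h) // lerDr.
apply/eqP; rewrite -subr_eq0; apply/eqP/(rip_eq0 Hip).
by rewrite ripD // ripN // z0 l0 subr0.
Qed.

End Riesz.

(** * Finite powers of an inner product space *)

Section Power.
Variables (R : realType) (V : lmodType R[i]) (ip : V -> V -> R[i]).
Hypothesis Hip : is_inner_product ip.
Variable n : nat.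
Local Notation Vn := {ffun 'I_n -> V}.

Definition ip_pow (f g : Vn) : R[i] := \sum_i ip (f i) (g i).

Lemma Re_sum (I : finType) (F : I -> R[i]) :
  complex.Re (\sum_i F i) = \sum_i complex.Re (F i).
Proof.
apply: (big_rec2 (fun (a : R[i]) (b : R) => complex.Re a = b)) => // i a b _ <-.
by case: (F i) a => ? ? [].
Qed.

Lemma rip_pow (f g : Vn) : real_ip ip_pow f g = \sum_i real_ip ip (f i) (g i).
Proof. exact: Re_sum. Qed.

Lemma ip_pow_inner_product : is_inner_product ip_pow.
Proof.
have [H1 H2 H3 H4] := Hip; split.
- move=> c f g h; rewrite /ip_pow mulr_sumr -big_split /=.
  by apply: eq_bigr => i _; rewrite !ffunE H1.
- move=> f g; rewrite /ip_pow rmorph_sum /=.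
  by apply: eq_bigr => i _; exact: H2.
- by move=> f; apply: sumr_ge0 => i _; exact: H3.
- move=> f /eqP; rewrite psumr_eq0; last by move=> i _; exact: H3.
  by move=> /allP h; apply/ffunP => i; rewrite ffunE; apply/H4/eqP/h/mem_index_enum.
Qed.

Lemma nrm_coord (f : Vn) i : nrm ip (f i) <= nrm ip_pow f.
Proof.
apply: nrm_le => //; first exact: nrm_ge0.
rewrite (nrm_sqr ip_pow_inner_product) rip_pow (bigD1 i) //= lerDl.
by apply: sumr_ge0 => j _; exact: rip_ge0.
Qed.

Lemma nrm_pow_le (f : Vn) : nrm ip_pow f <= \sum_i nrm ip (f i).
Proof.
apply: nrm_le; [exact: ip_pow_inner_product|by apply: sumr_ge0 => i _; exact: nrm_ge0|].
rewrite rip_pow expr2 mulr_suml; apply: ler_sum => i _.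
rewrite -(nrm_sqr Hip) expr2 ler_wpM2l ?nrm_ge0 // (bigD1 i) //= lerDl.
by apply: sumr_ge0 => j _; exact: nrm_ge0.
Qed.

Definition set_pow (K : set V) : set Vn := [set f | forall i, K (f i)].

Lemma set_pow_subspace K : is_subspace K -> is_subspace (set_pow K).
Proof.
move=> [K0 KL]; split=> [i|c f g Kf Kg i]; first by rewrite ffunE.
by rewrite !ffunE; exact: KL (Kf i) (Kg i).
Qed.

Lemma set_pow_complete K : complete_in ip K -> complete_in ip_pow (set_pow K).
Proof.
move=> Kc u Ku cau.
have /choice[l Hl] (i : 'I_n) : exists l, K l /\ forall e : R, 0 < e ->
    exists N, forall k, (N <= k)%N -> nrm ip (u k i - l) < e.
  apply: (Kc (fun k => u k i)) => [k|e e0]; first exact: Ku.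
  have [N HN] := cau e e0; exists N => p q Np Nq.
  apply: le_lt_trans (HN p q Np Nq).
  by have := nrm_coord (u p - u q) i; rewrite !ffunE.
exists [ffun i => l i]; split=> [i|e e0]; first by rewrite ffunE; case: (Hl i).
(* Dividing by [n.+1] rather than [n] covers [n = 0] and keeps the sum of [n] terms strictly below
   [e]. *)
have en : 0 < e / n.+1%:R by rewrite divr_gt0 // ltr0n.
have /choice[N HN] (i : 'I_n) := (Hl i).2 _ en.
exists (\max_i N i) => k Nk; apply: le_lt_trans (nrm_pow_le _) _.
apply: (@le_lt_trans _ _ (\sum_(i < n) e / n.+1%:R)).
  apply: ler_sum => i _; rewrite !ffunE; apply/ltW/HN.
  by apply: leq_trans Nk; exact: leq_bigmax.
rewrite sumr_const card_ord -[X in X < _]mulr_natl mulrCA gtr_pMr //.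
by rewrite ltr_pdivrMr ?ltr0n // mul1r ltr_nat.
Qed.

End Power.

(** * Operators on a locally Hilbert space *)

Section LocallyHilbert.
Variables (R : realType) (V : lmodType R[i]) (ip : V -> V -> R[i]).
Variables (L : Type) (le : L -> L -> Prop) (K : L -> set V).
Hypothesis HH : locally_hilbert ip le K.
Local Notation nrm := (nrm ip).
Local Notation rip := (real_ip ip).
Local Notation opnorm := (opnorm ip K).
Local Notation loc_adjoint := (loc_adjoint ip K).
Local Notation Bloc := (Bloc ip K le).
Implicit Types (T S : V -> V) (a b c : L) (x y : V).

Let Hip : is_inner_product ip. Proof. by case: HH. Qed.
Let ripE := (ripE Hip).

Lemma InP (s : seq V) x : List.In x s <-> x \in s.
Proof.
elim: s => [|y s IH] //=; rewrite inE; split.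
  by case=> [->|/IH ->]; rewrite ?eqxx ?orbT.
by case/orP => [/eqP ->|/IH ?]; [left|right].
Qed.

Lemma K0 a : K a 0.
Proof. by case: HH => _ _ /(_ a) [[]]. Qed.

Lemma KL a (c : R[i]) x y : K a x -> K a y -> K a (c *: x + y).
Proof. by case: HH => _ _ /(_ a) [[_ H] _] _ _; apply: H. Qed.

Lemma KZ a (c : R[i]) x : K a x -> K a (c *: x).
Proof. by move=> ?; rewrite -[c *: x]addr0; apply: KL => //; exact: K0. Qed.

Lemma KD a x y : K a x -> K a y -> K a (x + y).
Proof. by move=> ? ?; rewrite -[x]scale1r; apply: KL. Qed.

Lemma KB a x y : K a x -> K a y -> K a (x - y).
Proof. by move=> ? ?; rewrite addrC -scaleN1r; apply: KL. Qed.

Lemma K_real_subspace a : real_subspace (K a).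
Proof. by split=> [|x y|t x]; [exact: K0|exact: KD|exact: KZ]. Qed.

Lemma K_complete a : complete_in ip (K a).
Proof. by case: HH => _ _ /(_ a) []. Qed.

Lemma K_mono a b x : le a b -> K a x -> K b x.
Proof. by case: HH => _ _ _ H _ /H; apply. Qed.

Lemma le_upper a b : exists c, le a c /\ le b c.
Proof. by case: HH => _ [_ _ H] _ _ _; apply: H. Qed.

Lemma K_cover x : exists a, K a x.
Proof. by case: HH. Qed.

Lemma K_common (s : seq V) : exists a, forall x, x \in s -> K a x.
Proof.
elim: s => [|y s [a IH]]; first by have [a _] := K_cover 0; exists a.
have [b Kb] := K_cover y; have [c [ac bc]] := le_upper a b.
exists c => x; rewrite inE => /orP[/eqP -> | /IH Kx]; [exact: K_mono bc Kb|exact: K_mono ac Kx].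
Qed.

Lemma le_common (s : seq L) : exists a, forall b, List.In b s -> le b a.
Proof.
elim: s => [|b s [a IH]]; first by have [a _] := K_cover 0; exists a.
have [c [ac bc]] := le_upper a b; exists c => d /= [<- //|/IH da].
by case: HH => _ [_ tr _] _ _ _; apply: tr da ac.
Qed.

Section LinearMap.
Variable T : V -> V.
Hypothesis linT : is_linear_map T.

Lemma linmapD x y : T (x + y) = T x + T y.
Proof. by rewrite -[x in LHS]scale1r linT scale1r. Qed.

Lemma linmap0 : T 0 = 0.
Proof. by have := linmapD 0 0; rewrite addr0 -[X in X = _]addr0 => /addrI. Qed.

Lemma linmapZ (c : R[i]) x : T (c *: x) = c *: T x.
Proof. by rewrite -[c *: x]addr0 linT linmap0 addr0. Qed.

Lemma linmapB x y : T (x - y) = T x - T y.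
Proof. by rewrite -scaleN1r linmapD linmapZ scaleN1r. Qed.

End LinearMap.

Definition bounded_on T a (r : R) := forall x, K a x -> nrm (T x) <= r * nrm x.

Lemma opnorm_le T a (r : R) : is_linear_map T -> 0 <= r ->
  (opnorm T a <= r%:E)%E <-> bounded_on T a r.
Proof.
move=> linT r0; split=> [h x Kx|h].
  have [x0|x0] := eqVneq (nrm x) 0.
    by rewrite (nrm_eq0 Hip x0) (linmap0 linT) nrm0 // mulr0.
  have xp : 0 < nrm x by rewrite lt_def x0 nrm_ge0.
  have : ((nrm (T ((nrm x)^-1 *r x)))%:E <= r%:E)%E.
    apply: le_trans h; apply: ereal_sup_ubound.
    exists ((nrm x)^-1 *r x) => //; split; first exact: KZ.
    by rewrite nrmZ // ger0_norm ?invr_ge0 ?nrm_ge0 // mulVf.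
  rewrite lee_fin linmapZ // nrmZ // ger0_norm ?invr_ge0 ?nrm_ge0 //.
  by rewrite mulrC ler_pdivrMr.
apply: ge_ereal_sup => _ [x [Kx x1] <-]; rewrite lee_fin.
by apply: le_trans (h x Kx) _; rewrite ler_piMr.
Qed.

Lemma opnorm_fin T a : is_linear_map T ->
  (opnorm T a < +oo)%E <-> exists r, 0 <= r /\ bounded_on T a r.
Proof.
move=> linT; split=> [h|[r [r0 h]]]; last first.
  by apply: le_lt_trans (ltry r); apply/opnorm_le.
have h0 : (0%:E <= opnorm T a)%E.
  apply: ereal_sup_ubound; exists 0; last by rewrite linmap0 // nrm0.
  by split; [exact: K0|rewrite nrm0].
move: h0 h; case E : (opnorm T a) => [r| |] //; rewrite lee_fin => r0 _.
by exists r; split=> //; apply/opnorm_le => //; rewrite E.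
Qed.

Definition stable T := forall a x, K a x -> K a (T x).
Definition locally_bounded T := forall a, exists r, 0 <= r /\ bounded_on T a r.
Definition hermitian T := forall x y, rip (T x) y = rip x (T y).

Lemma BlocW T : Bloc T -> [/\ is_linear_map T, stable T & locally_bounded T].
Proof. by case=> linT stT bT _; split=> // a; apply/opnorm_fin. Qed.

(** Real and imaginary parts of [ip] are both values of [rip], and [T] commutes with multiplication
    by [-i]. *)
Lemma ip_of_rip T S : is_linear_map T ->
  (forall x y, rip (T x) y = rip x (S y)) -> forall x y, ip (T x) y = ip x (S y).
Proof. by move=> linT h x y; rewrite !(ip_rip Hip) h -linmapZ // h. Qed.

(** Compatibility with the projections is automatic: if [x] is orthogonal to [K a], then
    [<T x, y> = <x, T y> = 0] for [y] in the stable space [K a]. *)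
Lemma Bloc_hermitian T :
  is_linear_map T -> stable T -> locally_bounded T -> hermitian T -> Bloc T.
Proof.
move=> linT stT bT hT; split=> // [a|a b ab x Kx ox y Ky].
  exact/opnorm_fin.
by rewrite (ip_of_rip linT hT); apply: ox; apply: stT.
Qed.

(** The adjoint relation needs no index, since any two vectors lie in a common [K a]. *)
Lemma loc_adjointP T S : is_linear_map T ->
  loc_adjoint T S <-> stable S /\ forall x y, rip (T x) y = rip x (S y).
Proof.
move=> linT; split=> [h|[stS h] a]; last first.
  by split=> [x|x y _ _]; [exact: stS|exact: ip_of_rip].
split=> [a x|x y]; first by case: (h a) => + _; apply.
have [a Ka] := K_common [:: x; y].
by rewrite /real_ip (h a).2 //; apply: Ka; rewrite !inE eqxx ?orbT.
Qed.

Lemma orthogonal_projection a x :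
  exists p, K a p /\ forall y, K a y -> rip y (x - p) = 0.
Proof.
have [|||p [Kp _ hp]] := @riesz_adherent _ _ _ Hip _ _ (fun y => rip y x) (nrm x)
    (@K_complete a) (@subset_refl _ _) (K_real_subspace a).
- by move=> y z _ _; rewrite !ripE.
- by move=> t z _; rewrite !ripE.
- by move=> z _; rewrite mulrC; apply: cauchy_schwarz.
by exists p; split=> // y Ky; rewrite !ripE (hp y Ky) subrr.
Qed.

(** The Riesz vector of [<T x, y>] on [K a] represents it on all of [V], because [T] maps vectors
    orthogonal to [K a] to such vectors. It is therefore independent of [a], and the local adjoints
    glue. *)
Lemma ex_adjoint T : Bloc T -> exists S, loc_adjoint T S.
Proof.
move=> BT; have [linT stT bT] := BlocW BT.
have loc a y : K a y -> exists s, K a s /\ forall x, rip (T x) y = rip x s.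
  move=> Ky; have [r [r0 hr]] := bT a.
  have [|||s [Ks _ hs]] := @riesz_adherent _ _ _ Hip _ _ (fun x => rip (T x) y)
      (r * nrm y) (@K_complete a) (@subset_refl _ _) (K_real_subspace a).
  - by move=> x z _ _; rewrite linmapD // !ripE.
  - by move=> t x _; rewrite linmapZ // !ripE.
  - move=> x Kx; apply: le_trans (cauchy_schwarz Hip _ _) _.
    by rewrite mulrAC ler_wpM2r ?nrm_ge0 // hr.
  exists s; split=> // x.
  have [p [Kp hp]] := orthogonal_projection a x.
  have [d Kd] := K_cover x; have [b [ab db]] := le_upper a d.
  have Kxp : K b (x - p) by apply: KB; [apply: K_mono db Kd|apply: K_mono ab Kp].
  (* [Bloc] asks for orthogonality in [ip]; it follows from the real one because [K a] is closed
     under multiplication by [i]. *)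
  have Txp : ip (T (x - p)) y = 0.
    case: BT => _ _ _ /(_ a b ab (x - p) Kxp); apply=> // z Kz.
    by rewrite (ip_rip Hip) (ripZi Hip) !(ripC Hip (x - p)) !hp //; apply: KZ.
  rewrite -[x in LHS](subrK p) linmapD // ripD // {1}/real_ip Txp add0r hs //.
  by apply/eqP; rewrite -subr_eq0 -opprB oppr_eq0 -(ripN Hip) -ripD // (ripC Hip) hp.
have /choice[S HS] y : exists s, forall x, rip (T x) y = rip x s.
  by have [a Ka] := K_cover y; have [s [_ hs]] := loc a y Ka; exists s.
exists S; apply/loc_adjointP => //; split=> [a y Ky|x y]; last exact: HS.
have [s [Ks hs]] := loc a y Ky.
suff -> : S y = s by [].
by apply: (rip_ext Hip) => z; rewrite !(ripC Hip _ z) -hs -HS.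
Qed.

(** * The inverse of [1 + T^2] for hermitian [T] *)

Section Resolvent.
Variable T : V -> V.
Hypotheses (linT : is_linear_map T) (stT : stable T).
Hypotheses (bT : locally_bounded T) (hT : hermitian T).

(** One has [|y + T^2 y|^2 = |y|^2 + 2 |T y|^2 + |T^2 y|^2]; the second bound also uses
    [|y - T^2 y|^2 >= 0] and is the operator form of [|2 t / (1 + t^2)| <= 1]. *)
Lemma resolvent_nrm y : nrm y <= nrm (y + T (T y)) /\ 2 * nrm (T y) <= nrm (y + T (T y)).
Proof.
have H1 := rip_ge0 Hip (T y); have H2 := rip_ge0 Hip (T (T y)).
have := rip_ge0 Hip (y - T (T y)).
have E : rip (T (T y)) y = rip (T y) (T y) by rewrite hT.
rewrite !ripE (ripC Hip y) !E => H3.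
split; last rewrite -(@ger0_norm _ 2) ?ler0n // -nrmZ //.
  by apply: nrm_le; rewrite ?nrm_ge0 // nrm_sqr // !ripE (ripC Hip y) !E; lra.
by apply: nrm_le; rewrite ?nrm_ge0 // nrm_sqr // !ripE (ripC Hip y) !E; lra.
Qed.

Lemma resolventB x y : (x + T (T x)) - (y + T (T y)) = (x - y) + T (T (x - y)).
Proof. by rewrite !(linmapB linT) opprD addrACA. Qed.

Lemma resolvent_inj x y : x + T (T x) = y + T (T y) -> x = y.
Proof.
move=> h; have [+ _] := resolvent_nrm (x - y).
rewrite -resolventB h subrr nrm0 // => H; apply/eqP; rewrite -subr_eq0; apply/eqP.
by apply: (nrm_eq0 Hip); apply/eqP; rewrite eq_le H nrm_ge0.
Qed.

(* The range of [1 + T^2] on [K a] is closed since [1 + T^2] is bounded below, and dense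
   since a vector [z] orthogonal to it satisfies [|z|^2 + |T z|^2 = 0]. *)
Lemma resolvent_solve a x : K a x -> exists y, K a y /\ y + T (T y) = x.
Proof.
move=> Kx.
pose W := [set y + T (T y) | y in K a].
have Wsub : real_subspace W.
  split; first by exists 0; [exact: K0|rewrite !(linmap0 linT) addr0].
    by move=> _ _ [y Ky <-] [z Kz <-]; exists (y + z); [exact: KD|rewrite !(linmapD linT) addrACA].
  by move=> t _ [y Ky <-]; exists (t *r y); [exact: KZ|rewrite !(linmapZ linT) scalerDr].
have [||||l [Kl Wl lx]] := @riesz_adherent _ _ _ Hip (K a) W (fun w => rip w x) (nrm x)
    (@K_complete a) _ Wsub.
- by move=> _ [y Ky <-]; apply: KD => //; apply/stT/stT.
- by move=> y z _ _; rewrite !ripE.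
- by move=> t z _; rewrite !ripE.
- by move=> z _; rewrite mulrC; apply: cauchy_schwarz.
have -> : x = l.
  apply/eqP; rewrite -subr_eq0; apply/eqP/(rip_eq0 Hip).
  have Kz : K a (x - l) by apply: KB.
  have := lx (x - l + T (T (x - l))); move=> /(_ (ex_intro2 _ _ _ Kz erefl)) /eqP.
  rewrite -subr_eq0 -(ripNr Hip) -(ripDr Hip) (ripD Hip) hT => /eqP.
  by have := rip_ge0 Hip (T (x - l)); have := rip_ge0 Hip (x - l); lra.
have /choice[u Hu] (n : nat) : exists y, K a y /\ nrm (y + T (T y) - l) < n.+1%:R^-1.
  have [|_ [[y Ky <-] h]] := Wl n.+1%:R^-1; first by rewrite invr_gt0 ltr0n.
  by exists y.
have [n|e e0|y [Ky uy]] := @K_complete a u; first by case: (Hu n).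
  have [|N HN] := @small_inv R (e / 2); first by rewrite divr_gt0.
  exists N => i j Ni Nj.
  apply: le_lt_trans (resolvent_nrm _).1 _; rewrite -resolventB.
  apply: le_lt_trans (nrm_triangle Hip l _ _) _; rewrite (nrmB Hip l).
  have := HN _ Ni; have := HN _ Nj; have := (Hu i).2; have := (Hu j).2.
  move: (i.+1%:R^-1) (j.+1%:R^-1) => p q.
  lra.
exists y; split=> //; apply/eqP; rewrite -subr_eq0; apply/eqP/(nrm_eq0 Hip).
have [r [r0 hr]] := bT a.
(* Replacing [y] by [u n] costs [e + r^2 e], and [u n] solves the equation up to [e]. *)
apply: (@eps_eq0 _ _ (2 + r * r)); first by have := mulr_ge0 r0 r0; lra.
move=> e e0; rewrite ger0_norm ?nrm_ge0 //.
have [N1 HN1] := uy e e0; have [N2 HN2] := @small_inv R e e0.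
pose n := maxn N1 N2.
have h1 : nrm (u n - y) < e by apply: HN1; rewrite leq_maxl.
have h2 : n.+1%:R^-1 < e by apply: HN2; rewrite leq_maxr.
have [Kun h3] := Hu n.
apply: le_trans (nrm_triangle Hip (u n + T (T (u n))) _ _) _.
rewrite (nrmB Hip (y + _)) resolventB.
apply: le_trans (lerD (nrmD Hip _ _) (lexx _)) _.
have Kd : K a (u n - y) by apply: KB.
have h4 := hr _ Kd; have h5 := hr _ (stT Kd).
have h6 := ler_wpM2l r0 h4; have h7 := ler_wpM2l (mulr_ge0 r0 r0) (ltW h1).
move: h2 h3; move: (n.+1%:R^-1) => p; lra.
Qed.

(** By injectivity the solution is linear in [x] and does not depend on the [K a] in which it was
    found. *)
Lemma ex_resolvent : exists B, [/\ is_linear_map B, stable B & forall x, B x + T (T (B x)) = x].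
Proof.
have /choice[B HB] x : exists y, y + T (T y) = x.
  by have [a Ka] := K_cover x; have [y [_ hy]] := resolvent_solve Ka; exists y.
exists B; split=> // [c x y|a x Kx].
  apply: resolvent_inj; rewrite HB !linT addrACA -scalerDr.
  by rewrite !HB.
have [y [Ky hy]] := resolvent_solve Kx.
by rewrite (@resolvent_inj (B x) y) // HB.
Qed.

End Resolvent.

(** The composite [T B] is [t / (1 + t^2)] applied to [T], half of the function [f] in Kaplansky's
    argument. *)
Lemma cayley_ex T : is_linear_map T -> stable T -> locally_bounded T -> hermitian T ->
  exists B, [/\ is_linear_map B, stable B, forall x, B x + T (T (B x)) = x,
    hermitian (fun x => T (B x)) & forall x, 2 * nrm (T (B x)) <= nrm x].
Proof.
move=> linT stT bT hT; have [B [linB stB HB]] := ex_resolvent linT stT bT hT.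
exists B; split=> // [x y|x].
  by rewrite -[in RHS](HB x) -[y in LHS]HB !ripE !hT.
by have [_] := resolvent_nrm hT (B x); rewrite HB.
Qed.

(** * Density in a locally C*-subalgebra *)

Section Subalgebra.
Variable A : set (V -> V).
Hypothesis HA : loc_Cstar_subalgebra ip K le A.
Local Notation Asa := (sa_part ip K A).

Lemma A_Bloc T : A T -> Bloc T.
Proof. by case: HA => H _; apply: H. Qed.

Lemma A_D S T : A S -> A T -> A (fun x => S x + T x).
Proof.
case: HA => _ [_ [H _]] AS AT; have := H 1 S T AS AT.
by under eq_fun do rewrite scale1r.
Qed.

Lemma A_Z (c : R[i]) T : A T -> A (fun x => c *: T x).
Proof.
case: HA => _ [A0 [H _]] AT; have := H c T _ AT A0.
by under eq_fun do rewrite addr0.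
Qed.

Lemma A_M S T : A S -> A T -> A (fun x => S (T x)).
Proof. by case: HA => _ [_ [_ [H _]]]; apply: H. Qed.

Lemma A_adjoint T S : A T -> loc_adjoint T S -> A S.
Proof. by case: HA => _ [_ [_ [_ [H _]]]]; apply: H. Qed.

(** Directedness replaces finitely many seminorms by the one of a common upper index. *)
Lemma A_closed T : Bloc T ->
  (forall a (e : R), 0 < e -> exists S, A S /\ bounded_on (fun x => T x - S x) a e) -> A T.
Proof.
case: HA => _ [_ [_ [_ [_ H]]]] BT h; apply: H => // s e e0.
have [a sa] := le_common s; have [S [AS hS]] := h a e e0.
exists S; split=> // b /sa ba; apply/opnorm_le; last 1 first.
- by move=> x Kx; apply: hS; apply: K_mono ba Kx.
- move=> c x y; have [linT _ _] := BlocW BT; have [linS _ _] := BlocW (A_Bloc AS).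
  by rewrite linT linS scalerBr opprD addrACA.
- exact: ltW.
Qed.

Lemma AsaP T : Asa T <-> A T /\ hermitian T.
Proof.
split=> [[AT aT]|[AT hT]]; split=> //; have [linT stT _] := BlocW (A_Bloc AT).
  by have [_] := (loc_adjointP T linT).1 aT.
exact/loc_adjointP.
Qed.

Lemma Asa_subspace_image n (h : 'I_n -> V) :
  real_subspace [set [ffun i => S (h i)] | S in Asa].
Proof.
split.
- exists (fun=> 0); last by apply/ffunP => i; rewrite !ffunE.
  by apply/AsaP; split=> [|x y]; [case: HA => _ []|rewrite !ripE].
- move=> _ _ [S /AsaP[AS hS] <-] [T /AsaP[AT hT] <-].
  exists (fun x => S x + T x); last by apply/ffunP => i; rewrite !ffunE.
  by apply/AsaP; split=> [|x y]; [exact: A_D|rewrite !ripE hS hT].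
- move=> t _ [S /AsaP[AS hS] <-].
  exists (fun x => t *r S x); last by apply/ffunP => i; rewrite !ffunE.
  by apply/AsaP; split=> [|x y]; [exact: A_Z|rewrite !ripE hS].
Qed.

(** * Strong density of the self-adjoint part *)

Definition sot_adherent (X : set (V -> V)) T := forall (s : seq V) (e : R), 0 < e ->
  exists S, X S /\ forall x, x \in s -> nrm (T x - S x) < e.

Lemma sot_closureP X T : sot_closure ip K le X T <-> Bloc T /\ sot_adherent X T.
Proof.
split=> -[BT h]; split=> // s e e0; have [S [XS hS]] := h s e e0; exists S; split=> // x.
  by move=> /InP; exact: hS.
by move=> /InP; exact: hS.
Qed.

(** The adjoint is weakly but not strongly continuous: in [(S + S') / 2] the term [<S' h, z>] equals
    [<h, S z>], so it suffices that [S] is close to [T] at the vectors [h] and [z]. *)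
Lemma weak_approx T n (h z : 'I_n -> V) (e : R) :
  hermitian T -> sot_adherent A T -> 0 < e ->
  exists S, Asa S /\ `|\sum_i rip (S (h i) - T (h i)) (z i)| < e.
Proof.
move=> hT AT e0.
pose D := \sum_i (nrm (z i) + nrm (h i)).
have D0 : 0 <= D by apply: sumr_ge0 => i _; rewrite addr_ge0 ?nrm_ge0.
have D1 : 0 < 1 + D by rewrite ltr_pwDl.
have d0 : 0 < e / (1 + D) by rewrite divr_gt0.
have [S [AS HS]] := AT (codom h ++ codom z) _ d0.
have [linS stS _] := BlocW (A_Bloc AS).
have [S' adS] := ex_adjoint (A_Bloc AS).
have [_ S'E] := (loc_adjointP S' linS).1 adS.
have S'E' x y : rip (S' x) y = rip x (S y) by rewrite (ripC Hip) -S'E (ripC Hip).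
have AS' := A_adjoint AS adS.
exists (fun x => 2^-1 *r (S x + S' x)); split.
  apply/AsaP; split=> [|x y]; first by apply/A_Z/A_D.
  by rewrite !ripE S'E S'E' addrC.
apply: le_lt_trans (ler_norm_sum _ _ _) _.
apply: (@le_lt_trans _ _ (\sum_i e / (1 + D) * (nrm (z i) + nrm (h i)))).
  apply: ler_sum => i _.
  have -> : rip (2^-1 *r (S (h i) + S' (h i)) - T (h i)) (z i) =
      - 2^-1 * (rip (T (h i) - S (h i)) (z i) + rip (h i) (T (z i) - S (z i))).
    by rewrite !ripE S'E' -hT; field.
  have h1 : nrm (T (h i) - S (h i)) <= e / (1 + D).
    by apply/ltW/HS; rewrite mem_cat codom_f.
  have h2 : nrm (T (z i) - S (z i)) <= e / (1 + D).
    by apply/ltW/HS; rewrite mem_cat codom_f orbT.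
  have h3 := cauchy_schwarz Hip (T (h i) - S (h i)) (z i).
  have h4 := cauchy_schwarz Hip (h i) (T (z i) - S (z i)).
  have h5 := ler_wpM2r (nrm_ge0 ip (z i)) h1.
  have h6 := ler_wpM2l (nrm_ge0 ip (h i)) h2.
  rewrite normrM normrN [`|2^-1|]ger0_norm ?invr_ge0 ?ler0n // mulrDr.
  have := ler_normD (rip (T (h i) - S (h i)) (z i)) (rip (h i) (T (z i) - S (z i))).
  have := normr_ge0 (rip (T (h i) - S (h i)) (z i) + rip (h i) (T (z i) - S (z i))).
  lra.
rewrite -mulr_sumr -/D mulrAC ltr_pdivrMr // ltr_pM2l //; lra.
Qed.

(* Convexity: on [K_a^n] the norm closure and the weak closure of the real subspace
   [{(S h_1, ..., S h_n) : S in A_sa}] agree. *)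
Lemma sa_dense T : is_linear_map T -> stable T -> hermitian T ->
  sot_adherent A T -> sot_adherent Asa T.
Proof.
move=> linT stT hT AT s e e0.
have [a Ka] := K_common s.
pose h (i : 'I_(size s)) := nth 0 s i.
have Kh i : K a (h i) by apply/Ka/mem_nth.
have Ksub : is_subspace (K a) by case: HH => _ _ /(_ a) [].
have [|||f [[S SA <-] hS]] := @weakly_adherent _ _ _ (ip_pow_inner_product Hip (size s))
    _ _ [ffun i => T (h i)] (set_pow_complete Hip (@K_complete a))
    (set_pow_subspace _ Ksub) _ (Asa_subspace_image h) _ _ e e0.
- move=> _ [S /AsaP[AS _] <-] i; rewrite ffunE.
  by have [_ stS _] := BlocW (A_Bloc AS); apply: stS.
- by move=> i; rewrite ffunE; apply: stT.
- move=> z d Kz d0; have [S [SA hS]] := weak_approx h z hT AT d0.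
  exists [ffun i => S (h i)]; split; first by exists S.
  by rewrite rip_pow; under eq_bigr => i _ do rewrite !ffunE.
exists S; split=> // x /(nthP 0)[i si <-].
apply: le_lt_trans hS; rewrite (nrmB Hip).
by have := nrm_coord Hip ([ffun i => S (h i)] - [ffun i => T (h i)]) (Ordinal si); rewrite !ffunE.
Qed.

(** Since [A] may lack the identity, [B] may lie outside it. The approximants [Q n] avoid [B] and
    depend on [a] through the bound [r]; closedness of [A] needs only one approximant per [a] and
    [e]. *)
Lemma cayley_in_A T B : A T -> hermitian T -> is_linear_map B -> stable B ->
  (forall x, B x + T (T (B x)) = x) -> hermitian (fun x => T (B x)) ->
  (forall x, 2 * nrm (T (B x)) <= nrm x) ->
  A (fun x => T (B x)).
Proof.
move=> AT hT linB stB HB hG bG; have [linT stT bT] := BlocW (A_Bloc AT).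
have linG : is_linear_map (fun x => T (B x)) by move=> c x y; rewrite linB linT.
have bG1 x : nrm (T (B x)) <= nrm x.
  by have := bG x; have := nrm_ge0 ip (T (B x)); lra.
have BG : Bloc (fun x => T (B x)).
  apply: Bloc_hermitian => // [a x Kx|a]; first exact/stT/stB.
  by exists 1; split=> // x _; rewrite mul1r.
apply: A_closed => // a e e0.
have [r [r0 hr]] := bT a.
pose s := (1 + r ^+ 2)^-1.
have r2 : 0 <= r ^+ 2 by exact: sqr_ge0.
have r1 : 0 < 1 + r ^+ 2 by rewrite ltr_pwDl.
have s0 : 0 < s by rewrite invr_gt0.
(* Neumann iteration for [(1 + T^2)^-1 T], based on [0 <= r^2 - T^2 <= r^2] on [K a] *)
pose Q := fix Q n x := if n is m.+1 then
  s *r (T x + (r ^+ 2) *r Q m x + (- 1) *: T (T (Q m x))) else 0.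
have AQ n : A (Q n).
  elim: n => [|n IH]; first by case: HA => _ [].
  by apply/A_Z/A_D; [apply/A_D => //; exact: A_Z|exact/A_Z/A_M/A_M].
have KQ n x : K a x -> K a (Q n x).
  by have [_ stQ _] := BlocW (A_Bloc (AQ n)); apply: stQ.
pose k := s * r ^+ 2.
have k0 : 0 <= k by rewrite mulr_ge0 // ltW.
have k1 : k < 1 by rewrite /k mulrC ltr_pdivrMr // mul1r ltrDr.
(* [T B x] is a fixed point of the iteration, so the error [D] becomes [s (r^2 - T^2) D], of norm at
   most [s r^2 |D|]. *)
have step n x : K a x -> nrm (T (B x) - Q n.+1 x) <= k * nrm (T (B x) - Q n x).
  move=> Kx; set D := T (B x) - Q n x.
  have KD' : K a D by apply: KB; [exact/stT/stB|exact: KQ].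
  have -> : T (B x) - Q n.+1 x = s *r ((r ^+ 2) *r D - T (T D)).
    have E : T x = T (B x) + T (T (T (B x))) by rewrite -[in LHS](HB x) (linmapD linT).
    rewrite /= scaleN1r; apply: (rip_ext Hip) => z; rewrite E /D !(linmapB linT) !ripE.
    rewrite /s; field; exact: lt0r_neq0.
  clearbody D; rewrite nrmZ // ger0_norm ?(ltW s0) // /k -mulrA ler_pM2l //.
  apply: nrm_le => //; first by rewrite mulr_ge0 ?nrm_ge0.
  have E : rip (T (T D)) D = rip (T D) (T D) by rewrite hT.
  have h1 : rip (T (T D)) (T (T D)) <= r ^+ 2 * rip (T D) (T D).
    rewrite -!(nrm_sqr Hip) -exprMn ler_sqr ?nnegrE ?mulr_ge0 ?nrm_ge0 //.
    exact/hr/stT.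
  have h2 := mulr_ge0 r2 (rip_ge0 Hip (T D)).
  rewrite exprMn (nrm_sqr Hip) !ripE (ripC Hip D) !E.
  move: h1 h2; set X := rip (T D) (T D); lra.
have [n hn] := small_geometric k0 k1 e0.
exists (Q n); split=> // x Kx.
apply: (@le_trans _ _ (k ^+ n * nrm x)); last by rewrite ler_wpM2r ?nrm_ge0 ?(ltW hn).
(* As [Q 0 = 0], the initial error is [nrm (T (B x))], at most [nrm x]. *)
elim: n {hn} => [|n IH]; first by rewrite expr0 mul1r subr0.
by apply: le_trans (step n x Kx) _; rewrite exprS -mulrA ler_wpM2l.
Qed.

(** * Algebraic operations on strong limits *)

Lemma sot_adherent_le X Y T : X `<=` Y -> sot_adherent X T -> sot_adherent Y T.
Proof. by move=> XY h s e /(h s)[S [/XY ? ?]]; exists S. Qed.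

Lemma sot_adherent_D S T : sot_adherent A S -> sot_adherent A T ->
  sot_adherent A (fun x => S x + T x).
Proof.
move=> AS AT s e e0; have e2 : 0 < e / 2 by rewrite divr_gt0.
have [S' [AS' h1]] := AS s _ e2; have [T' [AT' h2]] := AT s _ e2.
exists (fun x => S' x + T' x); split=> [|x xs]; first exact: A_D.
rewrite opprD addrACA; apply: le_lt_trans (nrmD Hip _ _) _.
by rewrite [e]splitr ltrD ?h1 ?h2.
Qed.

Lemma sot_adherent_Z t T : sot_adherent A T -> sot_adherent A (fun x => t *r T x).
Proof.
move=> AT s e e0; have t1 : 0 < `|t| + 1 by rewrite ltr_pwDr.
have [|T' [AT' h]] := AT s (e / (`|t| + 1)); first by rewrite divr_gt0.
exists (fun x => t *r T' x); split=> [|x xs]; first exact: A_Z.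
rewrite -scalerBr nrmZ //; have := h x xs; rewrite ltr_pdivlMr // mulrDr mulr1 mulrC.
by have := nrm_ge0 ip (T x - T' x); lra.
Qed.

(** Multiplication is not jointly strongly continuous, so the order of choice matters: first [S']
    close to [S] at the vectors [T x], then [T'] with a tolerance depending on the bound of [S'] on
    [K a]. *)
Lemma sot_adherent_M S T : stable T -> sot_adherent A S -> sot_adherent A T ->
  sot_adherent A (fun x => S (T x)).
Proof.
move=> stT AS AT s e e0; have e2 : 0 < e / 2 by rewrite divr_gt0.
have [S' [AS' h1]] := AS (map T s) _ e2.
have [linS' _ bS'] := BlocW (A_Bloc AS').
have [a Ka] := K_common s; have [r [r0 hr]] := bS' a.
have r1 : 0 < r + 1 by rewrite ltr_pwDr.
have [|T' [AT' h2]] := AT s (e / 2 / (r + 1)); first by rewrite divr_gt0.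
exists (fun x => S' (T' x)); split=> [|x xs]; first exact: A_M.
apply: le_lt_trans (nrm_triangle Hip (S' (T x)) _ _) _.
rewrite -(linmapB linS') [e]splitr; apply: ltr_leD; first by apply/h1/map_f.
have [_ stT' _] := BlocW (A_Bloc AT').
have Kd : K a (T x - T' x) by apply: KB; [apply/stT/Ka|apply/stT'/Ka].
apply: le_trans (hr _ Kd) _.
have := h2 x xs; rewrite ltr_pdivlMr // mulrDr mulr1 mulrC.
by have := nrm_ge0 ip (T x - T' x); lra.
Qed.

(** * Kaplansky's density argument *)

Lemma nrm_bound (s : seq V) : exists h : R, 0 < h /\ forall x, x \in s -> nrm x <= h.
Proof.
elim: s => [|y s [h [h0 IH]]]; first by exists 1.
exists (h + nrm y); split=> [|x]; first by rewrite ltr_wpDr ?nrm_ge0.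
rewrite inE => /orP[/eqP ->|/IH xh]; first by rewrite lerDr ltW.
by apply: le_trans xh _; rewrite lerDl nrm_ge0.
Qed.

(* With [f t = 2 t / (1 + t^2)], [f a x - f b x] is controlled by [a - b] at the two fixed
   vectors [y] and [b y], where [x = (1 + b^2) y]. *)
Lemma cayley_diff S T B x y : is_linear_map S -> hermitian S -> (forall x, B x + S (S (B x)) = x) ->
  (forall x, 2 * nrm (S (B x)) <= nrm x) -> x = y + T (T y) ->
  nrm (S (B x) - T y) <= nrm (T y - S y) + nrm (T (T y) - S (T y)).
Proof.
move=> linS hS HB bB xy.
pose d1 := S y - T y; pose d2 := T (T y) - S (T y).
have -> : S (B x) - T y = B d1 + S (B d2).
  (* Compare both sides after applying the injective operator [1 + S^2]; then [B] has norm at most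
     [1] and [S B] at most [1/2]. *)
  apply: (resolvent_inj linS hS).
  have E z : S (B z) + S (S (S (B z))) = S z by rewrite -(linmapD linS) HB.
  have -> : B d1 + S (B d2) + S (S (B d1 + S (B d2))) = d1 + S d2.
    by rewrite !(linmapD linS) (addrACA (B d1)) HB E -(linmapD linS).
  have -> : S (B x) - T y + S (S (S (B x) - T y)) = S x - (T y + S (S (T y))).
    by rewrite !(linmapB linS) -(E x) opprD addrACA.
  rewrite xy /d1 /d2 (linmapD linS) (linmapB linS).
  by apply: (rip_ext Hip) => z; rewrite !ripE; ring.
rewrite (nrmB Hip (T y)) -/d1 -/d2; apply: nrmD_le => //.
  by have [+ _] := resolvent_nrm hS (B d1); rewrite HB.
by apply: le_trans (bB d2); have := nrm_ge0 ip (S (B d2)); lra.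
Qed.

Lemma strict_contraction_dense T q : is_linear_map T -> stable T -> hermitian T ->
  sot_adherent A T -> 0 <= q -> q < 1 -> (forall x, nrm (T x) <= q * nrm x) ->
  sot_adherent [set S | Asa S /\ forall x, nrm (S x) <= nrm x] T.
Proof.
move=> linT stT hT AT q0 q1 qT s e e0.
(* solves [T = 2 S / (1 + S^2)], that is [S = (T + T S^2) / 2], by iteration *)
pose S := fix S n x := if n is m.+1 then 2^-1 *r (T x + T (S m (S m x))) else 0.
have linS n : is_linear_map (S n).
  elim: n => [|n IH] c x y /=; first by rewrite scaler0 addr0.
  by rewrite !IH !linT addrACA -scalerDr [LHS]scalerDr; congr (_ + _); rewrite !scalerA mulrC.
have stS n : stable (S n).
  elim: n => [|n IH] a x Kx; first exact: K0.
  by apply/KZ/KD; [exact: stT|apply/stT/IH/IH].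
have bS n x : nrm (S n x) <= nrm x.
  elim: n x => [|n IH] x; first by rewrite nrm0 ?nrm_ge0.
  rewrite /= nrmZ // ger0_norm ?invr_ge0 ?ler0n //.
  have h1 := nrmD Hip (T x) (T (S n (S n x))).
  have h2 := qT x; have h3 := qT (S n (S n x)).
  have h4 := le_trans (IH (S n x)) (IH x).
  have h5 : q * nrm x <= nrm x by rewrite ler_piMl ?nrm_ge0 ?(ltW q1).
  have h6 := ler_wpM2l q0 h4.
  lra.
(* Commutation with [T] is what makes [T S^2] hermitian. *)
have comm n x : S n (T x) = T (S n x).
  elim: n x => [|n IH] x /=; first by rewrite (linmap0 linT).
  by rewrite (linmapZ linT) (linmapD linT) !IH.
have hS n : hermitian (S n).
  elim: n => [|n IH] x y /=; first by rewrite !ripE.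
  by rewrite !ripE !hT !IH !comm.
have AS n : sot_adherent A (S n).
  elim: n => [|n IH].
    by move=> ? d d0; exists (fun=> 0); split; [case: HA => _ []|move=> x _; rewrite subrr nrm0].
  apply/sot_adherent_Z/sot_adherent_D => //; apply: sot_adherent_M => //.
    by move=> a x Kx; apply/stS/stS.
  exact: sot_adherent_M.
(* The difference of squares splits as [(S' - S) S' + S (S' - S)] with [S' = S n.+1] and [S = S n];
   the resulting factor [2] cancels [2^-1], leaving one factor [q]. *)
have dS n x : nrm (S n.+1 x - S n x) <= q ^+ n * nrm x.
  elim: n x => [|n IH] x; first by rewrite subr0 expr0 mul1r bS.
  have -> : S n.+2 x - S n.+1 x = 2^-1 *r T (S n.+1 (S n.+1 x) - S n (S n x)).
    rewrite -[S n.+2 x]/(2^-1 *r (T x + T (S n.+1 (S n.+1 x)))).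
    rewrite -[S n.+1 x in X in _ - X]/(2^-1 *r (T x + T (S n (S n x)))).
    rewrite (linmapB linT); apply: (rip_ext Hip) => z; rewrite !ripE; ring.
  rewrite nrmZ // ger0_norm ?invr_ge0 ?ler0n //.
  have h1 := qT (S n.+1 (S n.+1 x) - S n (S n x)).
  have h2 := nrm_triangle Hip (S n (S n.+1 x)) (S n.+1 (S n.+1 x)) (S n (S n x)).
  have h3 := IH (S n.+1 x).
  have h4 : nrm (S n (S n.+1 x) - S n (S n x)) <= q ^+ n * nrm x.
    by rewrite -(linmapB (linS n)); apply: le_trans (bS _ _) (IH x).
  have h5 := ler_wpM2l (exprn_ge0 n q0) (bS n.+1 x).
  have h6 : nrm (S n.+1 (S n.+1 x) - S n (S n x)) <= 2 * (q ^+ n * nrm x) by lra.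
  have h7 := ler_wpM2l q0 h6.
  rewrite exprS -mulrA; lra.
have [h [h0 hs]] := nrm_bound s.
(* With [y = B x], [T x] equals [2 S n.+1 y], so replacing it by [2 S n y] costs at most [e / 2].
   Passing from [S n] to [F] costs less than [2 (e / 8 + e / 8)]. *)
have [|n hn] := @small_geometric R q (e / (4 * h)) q0 q1.
  by rewrite divr_gt0 // mulr_gt0.
have bSn : locally_bounded (S n) by exists 1; split=> // x _; rewrite mul1r.
have [B [linB stB HB hB bB]] := cayley_ex (linS n) (stS n) bSn (hS n).
have e8 : 0 < e / 8 by rewrite divr_gt0.
(* By [cayley_diff], closeness at [B x] and [S n (B x)] for [x] in [s] controls the difference of
   the transforms at [x]. *)
have [F [/AsaP[AF hF] FS]] := sa_dense (linS n) (stS n) (hS n) (AS n)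
    (map B s ++ map (fun x => S n (B x)) s) e8.
have [linF stF bF] := BlocW (A_Bloc AF).
have [C [linC stC HC hC bC]] := cayley_ex linF stF bF hF.
exists (fun x => 2 *r F (C x)); split=> [|x xs].
  split=> [|x]; last by rewrite nrmZ // ger0_norm.
  apply/AsaP; split=> [|x y]; last by rewrite !ripE hC.
  exact/A_Z/cayley_in_A.
pose y := B x; have xy : x = y + S n (S n y) by rewrite HB.
have d1 : nrm (S n y - F y) < e / 8 by apply: FS; rewrite mem_cat map_f.
have d2 : nrm (S n (S n y) - F (S n y)) < e / 8.
  by apply: FS; rewrite mem_cat (map_f (fun x => S n (B x))) ?orbT.
have d3 := cayley_diff linF hF HC bC xy.
have d4 : T x - 2 *r S n y = 2 *r (S n.+1 y - S n y).
  rewrite xy (linmapD linT) /=.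
  by apply: (rip_ext Hip) => z; rewrite !ripE; field.
apply: le_lt_trans (nrm_triangle Hip (2 *r S n y) _ _) _.
rewrite d4 -scalerBr !nrmZ // ger0_norm // (nrmB Hip (S n y) (F (C x))).
have d5 : nrm (S n.+1 y - S n y) <= e / 4.
  apply: le_trans (dS n y) _; apply: (@le_trans _ _ (e / (4 * h) * h)).
    apply: ler_pM; rewrite ?exprn_ge0 ?nrm_ge0 ?(ltW hn) //.
    by apply: le_trans (hs x xs); have [+ _] := resolvent_nrm (hS n) y; rewrite -xy.
  by rewrite le_eqVlt; apply/orP; left; apply/eqP; field; rewrite gt_eqF.
lra.
Qed.

Lemma bounded_dense T (M : R) : 0 < M -> is_linear_map T -> stable T -> hermitian T ->
  sot_adherent A T -> (forall x, nrm (T x) <= M * nrm x) ->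
  sot_adherent [set S | Asa S /\ forall x, nrm (S x) <= M * nrm x] T.
Proof.
move=> M0 linT stT hT AT MT s e e0.
have [h [h0 hs]] := nrm_bound s.
have Mh := mulr_gt0 M0 h0.
have D0 : 0 < 2 * (M * h) + e by rewrite addr_gt0 ?mulr_gt0.
(* Shrinking [T] by [q = 1 - d] gains a strict contraction after division by [M]; this [d] makes the
   cost [d M h] smaller than [e / 2]. *)
pose d := e / (2 * (M * h) + e).
have d0 : 0 < d by rewrite divr_gt0.
have d1 : d < 1 by rewrite ltr_pdivrMr // mul1r ltrDr mulr_gt0.
have dE : d * (2 * (M * h) + e) = e by rewrite /d divfK // gt_eqF.
pose q := 1 - d.
have q0 : 0 <= q by rewrite subr_ge0 ltW.
have qM : 0 <= q / M by rewrite divr_ge0 // ltW.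
have [||||||S [[/AsaP[AS hS] bS] TS]] := @strict_contraction_dense
    (fun x => (q / M) *r T x) q _ _ _ (sot_adherent_Z _ AT) q0 _ _ s (e / (2 * M)) _.
- move=> c x y; rewrite linT scalerDr !scalerA; congr (_ *: _ + _); exact: mulrC.
- by move=> a x Kx; apply/KZ/stT.
- by move=> x y; rewrite !ripE hT.
- by rewrite /q; lra.
- move=> x; rewrite nrmZ // ger0_norm //.
  apply: le_trans (ler_wpM2l qM (MT x)) _.
  by rewrite mulrA divfK // gt_eqF.
- by rewrite divr_gt0 // mulr_gt0.
exists (fun x => M *r S x); split=> [|x xs].
  split=> [|x]; last by rewrite nrmZ // gtr0_norm // ler_pM2l.
  by apply/AsaP; split=> [|x y]; [exact: A_Z|rewrite !ripE hS].
have -> : T x - M *r S x = d *r T x + M *r ((q / M) *r T x - S x).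
  apply: (rip_ext Hip) => z; rewrite !ripE /q; field; exact: lt0r_neq0.
apply: le_lt_trans (nrmD Hip _ _) _; rewrite !nrmZ // (gtr0_norm d0) (gtr0_norm M0).
have h1 := TS x xs; rewrite -(ltr_pM2l M0) in h1.
have E : M * (e / (2 * M)) = e / 2 by field; exact: lt0r_neq0.
rewrite E in h1.
have h2 : nrm (T x) <= M * h by apply: le_trans (MT x) _; rewrite ler_pM2l ?hs.
have h3 := ler_wpM2l (ltW d0) h2.
have h4 := mulr_gt0 d0 e0.
lra.
Qed.

Lemma opnorm_le_all T (M : R) : is_linear_map T -> 0 <= M ->
  (forall a, (opnorm T a <= M%:E)%E) <-> forall x, nrm (T x) <= M * nrm x.
Proof.
move=> linT M0; split=> [h x|h a]; last by apply/opnorm_le.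
by have [a Ka] := K_cover x; apply: (opnorm_le a linT M0).1.
Qed.

(** * Properties inherited by strong limits *)

Lemma sot_limit_hermitian X T :
  (forall S, X S -> hermitian S) -> sot_adherent X T -> hermitian T.
Proof.
move=> hX XT x y; apply/eqP; rewrite -subr_eq0; apply/eqP.
apply: (@eps_eq0 _ _ (1 + nrm x + nrm y)).
  by have := nrm_ge0 ip x; have := nrm_ge0 ip y; lra.
move=> e e0; have [S [/hX hS TS]] := XT [:: x; y] e e0.
have h1 : nrm (T x - S x) < e by apply: TS; rewrite inE eqxx.
have h2 : nrm (T y - S y) < e by apply: TS; rewrite !inE eqxx orbT.
have -> : rip (T x) y - rip x (T y) = rip (T x - S x) y - rip x (T y - S y).
  by rewrite !ripE hS; ring.
have h3 := cauchy_schwarz Hip (T x - S x) y.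
have h4 := cauchy_schwarz Hip x (T y - S y).
have h5 := ler_wpM2r (nrm_ge0 ip y) (ltW h1).
have h6 := ler_wpM2l (nrm_ge0 ip x) (ltW h2).
have := ler_normB (rip (T x - S x) y) (rip x (T y - S y)).
lra.
Qed.

Lemma sot_limit_bounded X T (M : R) : (forall S, X S -> forall x, nrm (S x) <= M * nrm x) ->
  sot_adherent X T -> forall x, nrm (T x) <= M * nrm x.
Proof.
move=> bX XT x; rewrite leNgt; apply/negP => h.
have [|S [/bX bS TS]] := XT [:: x] (nrm (T x) - M * nrm x); first by rewrite subr_gt0.
have := TS x; rewrite inE eqxx => /(_ isT).
have := bS x; have := nrmD Hip (T x - S x) (S x); rewrite subrK; lra.
Qed.

End Subalgebra.
End LocallyHilbert.

Theorem mainTheorem5 (R : realType) (V : lmodType R[i]) (ip : V -> V -> R[i])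
    (L : Type) (le : L -> L -> Prop) (K : L -> set V)
    (HH : locally_hilbert ip le K)
    (A : set (V -> V)) (HA : loc_Cstar_subalgebra ip K le A) :
  let frakA := sot_closure ip K le A in
  sa_part ip K (frakA) `<=` sot_closure ip K le (sa_part ip K A) /\
  (forall M : R, 0 < M ->
     sot_closure ip K le
       [set a | sa_part ip K A a /\ forall al : L, (opnorm ip K a al <= M%:E)%E]
     = [set T | sa_part ip K frakA T /\ forall al : L, (opnorm ip K T al <= M%:E)%E]).
Proof.
move=> frakA.
have frakA_sa T : sa_part ip K frakA T ->
    [/\ Bloc ip K le T, sot_adherent ip A T, is_linear_map T, stable K T & hermitian ip T].
  move=> [/sot_closureP[BT AT] aT]; have [linT stT _] := BlocW HH BT.
  by split=> //; have [] := (loc_adjointP HH T linT).1 aT.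
split=> [T /frakA_sa[BT AT linT stT hT]|M M0].
  by apply/sot_closureP; split=> //; exact: (sa_dense HH HA).
apply/seteqP; split=> T.
  (* Hermiticity and the norm bound pass to strong limits; the reverse inclusion is
     [bounded_dense]. *)
  move=> /sot_closureP[BT XT]; have [linT stT _] := BlocW HH BT.
  split; last first.
    apply: (iffRL (opnorm_le_all HH linT (ltW M0))).
    apply: (sot_limit_bounded HH _ XT) => S [[AS _] bS].
    have [linS _ _] := BlocW HH (A_Bloc HA AS).
    exact: (iffLR (opnorm_le_all HH linS (ltW M0)) bS).
  split; first by apply/sot_closureP; split=> //; apply: sot_adherent_le XT => S [[]].
  apply: (iffRL (loc_adjointP HH T linT)); split=> //.
  by apply: (sot_limit_hermitian HH _ XT) => S [/(AsaP HH HA)[]].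
move=> [/frakA_sa[BT AT linT stT hT] bT]; apply/sot_closureP; split=> //.
have := bounded_dense HH HA M0 linT stT hT AT ((opnorm_le_all HH linT (ltW M0)).1 bT).
apply: sot_adherent_le => S [SA bS]; split=> //.
have [AS _] := SA; have [linS _ _] := BlocW HH (A_Bloc HA AS).
exact: (iffRL (opnorm_le_all HH linS (ltW M0)) bS).
Qed.
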